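(* Let $p>3$ be a prime and let $G=\langle a_1,a_2,a_3,a_4\mid [a_2,a_1]=a_3,\ a_1^p=a_4\rangle$ (with the trivial relations omitted). Then every automorphism $\alpha$ of $G$ can be written as $\alpha=\alpha(u_1,u_2,u_3,u_4,v_2,v_3,v_4)$, where $$a_1\mapsto a_1^{u_1}a_2^{u_2}a_3^{u_3}a_4^{u_4},\quad a_2\mapsto a_2^{v_2}a_3^{v_3}a_4^{v_4},\quad a_3\mapsto a_3^{u_1v_2},\quad a_4\mapsto a_4^{u_1},$$ with $u_1,u_2,u_3,u_4,v_2,v_3,v_4\in\{0,\dots,p-1\}$, $u_1\neq 0$ and $v_2\neq 0$.
   Context: $[h,g]=h^{-1}g^{-1}hg$. Presentation convention: $G$ is defined by the power-commutator presentation with the displayed relations together with all omitted trivial relations: $a_i^p=1$ for $i=2,3,4$ and $[a_j,a_i]=1$ for every pair $j>i$ other than $(j,i)=(2,1)$. So $G$ has order $p^4$. *)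

(* Defs.v *)
From mathcomp Require Import all_boot all_fingroup.

Set Implicit Arguments.
Unset Strict Implicit.
Unset Printing Implicit Defensive.

Local Open Scope group_scope.

(* G is the group < a1, a2, a3, a4 | [a2, a1] = a3, a1 ^ p = a4 > of the       *)
(* power-commutator convention: the other a_i have trivial p-th power and the *)
(* other pairs commute. In MathComp, [~ h, g] = h^-1 * g^-1 * h * g.          *)
(* \isog Grp fixes the isomorphism type only (the largest finite factor of    *)
(* the presented group, which is here that group itself, of order p ^ 4), so  *)
(* the remaining clauses single out the generators a_i. Nothing is lost: a     *)
(* generating tuple satisfying the relations induces a surjection onto G from *)
(* the presented group, which is an isomorphism as both have the same finite  *)
(* order.                                                                     *)
Definition presented (p : nat) (gT : finGroupType) (G : {group gT})
    (a1 a2 a3 a4 : gT) : Prop :=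
  [/\ G \isog Grp (x1 : x2 : x3 : x4 :
        [~ x2, x1] = x3, x1 ^+ p = x4,
        x2 ^+ p = 1, x3 ^+ p = 1, x4 ^+ p = 1,
        [~ x3, x1] = 1, [~ x3, x2] = 1,
        [~ x4, x1] = 1, [~ x4, x2] = 1, [~ x4, x3] = 1),
      <<[set a1; a2; a3; a4]>> = G,
      [~ a2, a1] = a3 /\ a1 ^+ p = a4,
      [/\ a2 ^+ p = 1, a3 ^+ p = 1 & a4 ^+ p = 1]
    & [/\ [~ a3, a1] = 1, [~ a3, a2] = 1,
          [~ a4, a1] = 1, [~ a4, a2] = 1 & [~ a4, a3] = 1]].

(* Main.v *)
Require Import Defs.
From mathcomp Require Import all_boot all_fingroup.
From mathcomp Require Import cyclic commutator center abelian extremal.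

Set Implicit Arguments.
Unset Strict Implicit.
Unset Printing Implicit Defensive.

Local Open Scope group_scope.

(** Both a3 and a4 are central of exponent p, so G has class at most 2 and every
    element has the form a1 ^+ i * a2 ^+ j * (a3 ^+ k * a4 ^+ l) with exponents
    below p (presented_normal_form).  Two computations then cut down the possible
    images of the generators.  As p is odd, the p-th power of such an element is
    a4 ^+ i (presented_p_power).  As commutators are bilinear, those of elements
    of a2 ^+ v * 'Z(G) with elements of a1 ^+ u * a2 ^+ w * 'Z(G) are
    a3 ^+ (u * v) (presented_commutator).

    Let alpha be an automorphism.  The image of a2 has order p, so its
    a1-exponent is 0; taking the p-th power of the image of a1 gives the image
    of a4, and commuting the images of a2 and a1 gives that of a3.  Finally
    u1 and v2 are nonzero because alpha is injective, while a3 and a4 are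
    nontrivial.

    This last point is where the presentation itself matters, since the
    relations alone also hold in the trivial group.  It is witnessed by a single
    finite quotient, the modular group of order p ^ 3
    (modular_homg_presented): it is not abelian, whereas a3 = 1 would make G
    abelian, and it contains an element of order p ^ 2, whereas a4 = 1 would give
    G exponent p. *)

(** With x of order p ^ 2, y of order p and x ^ y = x ^+ p.+1, the tuple
    (x, y, x ^- p, x ^+ p) satisfies the relations: [~ y, x] = x ^- p, and x ^+ p
    is central because [~ x, y] = x ^+ p has order p. *)
Lemma modular_homg_presented (p : nat) (gT : finGroupType) (G : {group gT})
    (a1 a2 a3 a4 : gT) :
  prime p -> presented p G a1 a2 a3 a4 -> 'Mod_(p ^ 3) \homg G.
Proof.
move=> p_pr [isoG _ _ _ _]; rewrite isoG.
have [[x y] gen_xy [oy xy]] :=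
  generators_modular_group p_pr (isT : 2 < 3) (isog_refl _).
have [[defM _ _] _ _ _ _] :=
  modular_group_structure p_pr (isT : 2 < 3) gen_xy (isog_refl _)
    (conj oy xy : modular_group_generators p 3 (x, y)).
have [_ Mx ox _] := gen_xy; rewrite /= expn1 in xy; rewrite /= in ox.
have xR : [~ x, y] = x ^+ p by rewrite commgEl xy expgS mulKg.
have xpp : (x ^+ p) ^+ p = 1 by rewrite -expgM -[(p * p)%N]/(p ^ 2)%N -ox expg_order.
have cxp : [~ x ^+ p, y] = 1.
  by rewrite commXg ?xR // /commute commuteX.
have yp : y ^+ p = 1 by have := expg_order y; rewrite oy.
have {}cxp : commute (x ^+ p) y by apply/commgP/eqP.
have cxx : commute (x ^+ p) x by apply/commute_sym/commuteX.
have cV z : commute (x ^+ p) z -> commute (x ^- p) z.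
  by move=> cz; apply/commute_sym/commuteV/commute_sym.
apply/existsP; exists (x, y, x ^- p, x ^+ p); rewrite /= !xpair_eqE.
rewrite -invg_comm xR expgVn xpp yp invg1 !eqxx /=.
rewrite !(introT commgP) //; last 3 first.
- exact/commuteV/commute_refl.
- exact: cV.
- exact: cV.
rewrite eqEsubset subsetT -(sdprodWY defM) /= !andbT -joingA.
exact: joing_subl.
Qed.

Section Presented.

Variables (p : nat) (gT : finGroupType) (G : {group gT}) (a1 a2 a3 a4 : gT).
Hypotheses (p_pr : prime p) (p_odd : odd p).
Hypothesis presG : presented p G a1 a2 a3 a4.

Let defR : [~ a2, a1] = a3. Proof. by have [_ _ []] := presG. Qed.
Let defX : a1 ^+ p = a4. Proof. by have [_ _ []] := presG. Qed.
Let a2p : a2 ^+ p = 1. Proof. by have [_ _ _ []] := presG. Qed.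
Let a3p : a3 ^+ p = 1. Proof. by have [_ _ _ []] := presG. Qed.
Let a4p : a4 ^+ p = 1. Proof. by have [_ _ _ []] := presG. Qed.

Lemma presented_mem : [/\ a1 \in G, a2 \in G, a3 \in G & a4 \in G].
Proof.
by have [_ <- _ _ _] := presG; split; rewrite mem_gen ?inE ?eqxx ?orbT.
Qed.

Lemma presented_center : a3 \in 'Z(G) /\ a4 \in 'Z(G).
Proof.
have [_ _ Ga3 Ga4] := presented_mem.
have [_ defG _ _ [/eqP/commgP c31 /eqP/commgP c32 /eqP/commgP c41]] := presG.
move=> /eqP/commgP c42 /eqP/commgP c43.
rewrite !inE Ga3 Ga4 -defG cent_gen.
by split; apply/centP=> x; rewrite !inE => /orP[/orP[/orP[]|]|] /eqP->.
Qed.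

Lemma presented_normal_form g : g \in G ->
  exists i j k l : 'I_p, g = a1 ^+ i * a2 ^+ j * (a3 ^+ k * a4 ^+ l).
Proof.
have [Za3 Za4] := presented_center; have [Ga1 Ga2 Ga3 Ga4] := presented_mem.
have cZ z h : z \in 'Z(G) -> h \in G -> commute z h.
  by case/centerP=> _ cz Gh; apply: cz.
have p_gt0 := prime_gt0 p_pr.
(* The product of the four cyclic groups is a group, built from the right:
   a4 centralises a3, both centralise a2, and a1 normalises what a2, a3 and a4
   generate, since a2 ^ a1 = a2 * a3. *)
have: G \subset <[a1]> * (<[a2]> * (<[a3]> * <[a4]>)).
  have [_ <- _ _ _] := presG.
  have c34 : <[a4]> \subset 'C(<[a3]>).
    by rewrite cent_cycle cycle_subG; apply/cent1P/cZ.
  have c2 : <[a3]> <*> <[a4]> \subset 'C(<[a2]>).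
    by rewrite cent_cycle join_subG !cycle_subG; apply/andP; split; apply/cent1P;
       exact: cZ.
  have n1 : <[a1]> \subset 'N(<[a2]> <*> (<[a3]> <*> <[a4]>)).
    rewrite cycle_subG inE -genJ gen_subG conjUg.
    rewrite subUset; apply/andP; split; last first.
      apply: (subset_trans _ (joing_subr _ _)).
      rewrite -genJ gen_subG conjUg subUset -!cycleJ.
      by rewrite /conjg (cZ _ a1 Za3 Ga1) (cZ _ a1 Za4 Ga1) !mulKg joing_subl joing_subr.
    rewrite -cycleJ cycle_subG -[a2 ^ a1](mulKVg a2) -commgEl defR.
    rewrite groupM // -cycle_subG ?joing_subl //.
    exact: subset_trans (joing_subl _ _) (joing_subr _ _).
  rewrite -(cent_joinEr c34) -(cent_joinEr c2) -(norm_joinEl n1) gen_subG.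
  rewrite !subUset !sub1set -!andbA.
  have inl x (A B : {set gT}) : x \in A -> x \in A <*> B.
    by move=> Ax; rewrite mem_gen // inE Ax.
  have inr x (A B : {set gT}) : x \in B -> x \in A <*> B.
    by move=> Bx; rewrite mem_gen // inE Bx orbT.
  by apply/and4P; split;
     [apply: inl | apply/inr/inl | apply/inr/inr/inl | apply/inr/inr/inr];
     exact: cycle_id.
move/subsetP=> sG /sG /mulsgP[_ y /cycleP[i ->] + ->].
move=> /mulsgP[_ z /cycleP[j ->] + ->].
move=> /mulsgP[_ _ /cycleP[k ->] /cycleP[l ->] ->] {y z}.
exists (Ordinal (ltn_pmod i p_gt0)), (Ordinal (ltn_pmod j p_gt0)).
exists (Ordinal (ltn_pmod k p_gt0)), (Ordinal (ltn_pmod (i %/ p + l) p_gt0)) => /=.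
rewrite (expg_mod _ a2p) (expg_mod _ a3p) (expg_mod _ a4p) expgD.
(* The part of the exponent of a1 beyond p is carried over to a4 = a1 ^+ p. *)
have -> : a1 ^+ i = a1 ^+ (i %% p) * a4 ^+ (i %/ p).
  by rewrite {1}(divn_eq i p) addnC mulnC expgD expgM defX.
have Zq := groupX (i %/ p) Za4.
rewrite -!mulgA; congr (_ * _); rewrite (cZ _ _ Zq) ?groupM ?groupX //.
by rewrite -!mulgA (cZ _ _ Zq) ?groupX.
Qed.

(** Central factors drop out of the commutator, as does a2 ^+ w, which commutes
    with a2 ^+ v; bilinearity does the rest. *)
Lemma presented_commutator u v w z1 z2 : z1 \in 'Z(G) -> z2 \in 'Z(G) ->
  [~ a2 ^+ v * z1, a1 ^+ u * a2 ^+ w * z2] = a3 ^+ (u * v).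
Proof.
case/centerP=> Gz1 cz1 /centerP[Gz2 cz2].
have [Ga1 Ga2 _ _] := presented_mem.
have [/centerP[_ ca3] _] := presented_center.
have central_r x z : x \in G -> (forall y, y \in G -> commute z y) -> [~ x, z] = 1.
  by move=> Gx cz; apply/eqP/commgP/commute_sym/cz.
have central_l x z : x \in G -> (forall y, y \in G -> commute z y) -> [~ z, x] = 1.
  by move=> Gx cz; apply/eqP/commgP/cz.
rewrite commMgJ (central_l _ z1) ?groupM ?groupX // mulg1.
rewrite conjgE -cz1 ?groupR ?groupM ?groupX // mulKg.
rewrite commgMJ central_r ?groupX // mul1g conjgE -cz2 ?groupR ?groupM ?groupX //.
rewrite mulKg commgMJ.
have -> : [~ a2 ^+ v, a2 ^+ w] = 1.
  by apply/eqP/commgP/commuteX2.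
have R1 : [~ a2, a1 ^+ u] = a3 ^+ u.
  by rewrite commgX defR //; apply/commute_sym/ca3.
rewrite mul1g commXg ?R1; last exact/commuteX/commute_sym/ca3.
by rewrite conjgE -expgM (commuteX2 _ _ (ca3 _ Ga2)) mulKg.
Qed.

(** In class 2, (x * y) ^+ p = x ^+ p * y ^+ p * [~ y, x] ^+ 'C(p, 2), and for
    odd p the last factor vanishes because commutators have exponent p. *)
Lemma presented_p_power i j z :
  z \in 'Z(G) -> (a1 ^+ i * a2 ^+ j * z) ^+ p = a4 ^+ i * z ^+ p.
Proof.
move=> Zz; have [Ga1 Ga2 _ _] := presented_mem.
have [Za3 _] := presented_center.
have cZ x h : x \in 'Z(G) -> h \in G -> commute h x.
  by case/centerP=> _ cx Gh; apply/commute_sym/cx.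
rewrite expgMn; last by apply: cZ; rewrite ?groupM ?groupX.
congr (_ * _).
have R21 : [~ a2 ^+ j, a1 ^+ i] = a3 ^+ (i * j).
  by have := presented_commutator i j 0 (group1 _) (group1 _); rewrite !mulg1.
rewrite expMg_Rmul R21; try by apply: cZ; rewrite ?groupX.
rewrite expgAC defX (expgAC _ j) a2p expg1n mulg1.
have /dvdnP[q ->] : p %| 'C(p, 2).
  by apply: prime_dvd_bin => //; case: p p_pr p_odd => [|[|[|]]].
by rewrite (mulnC q) expgM (expgAC _ _ p) a3p !expg1n mulg1.
Qed.

Lemma presented_exponent : a4 = 1 -> exponent G %| p.
Proof.
move=> a4_1; apply/exponentP=> g /presented_normal_form[i [j [k [l ->]]]].
have [Za3 _] := presented_center.
rewrite a4_1 expg1n mulg1 presented_p_power ?groupX // a4_1 expg1n mul1g.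
by rewrite expgAC a3p expg1n.
Qed.

(** The modular group of order p ^ 3 contains an element of order p ^ 2, so it
    is not an image of a group of exponent p. *)
Lemma presented_a4_neq1 : a4 != 1.
Proof.
apply/eqP=> /presented_exponent expG.
have [f fG] := homgP (modular_homg_presented p_pr presG).
have [[x y] [_ Mx ox _] _] :=
  generators_modular_group p_pr (isT : 2 < 3) (isog_refl _).
have := dvdn_trans (dvdn_exponent Mx) (dvdn_trans _ expG).
rewrite -[X in exponent X %| _]fG exponent_morphim => /(_ isT).
by rewrite ox -{2}(expn1 p) (dvdn_Pexp2l _ _ (prime_gt1 p_pr)).
Qed.

(** If a3 = 1 then all the generators commute, while the modular group is not
    abelian. *)
Lemma presented_a3_neq1 : a3 != 1.
Proof.
apply/eqP=> a3_1.
have [f fG] := homgP (modular_homg_presented p_pr presG).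
have [[x y] gen_xy mod_xy] :=
  generators_modular_group p_pr (isT : 2 < 3) (isog_refl _).
have [[_ /negP nabM _] _ _ _ _] :=
  modular_group_structure p_pr (isT : 2 < 3) gen_xy (isog_refl _) mod_xy.
apply: nabM; rewrite /= -[X in abelian X]fG morphim_abelian //.
have [_ Za4] := presented_center; have [Ga1 Ga2 _ _] := presented_mem.
have /centerP[_ ca4] := Za4.
have c21 : commute a2 a1 by apply/commgP; rewrite defR a3_1.
have [_ <- _ _ _] := presG; rewrite abelian_gen.
apply/centsP=> u + v; rewrite a3_1 !inE.
by do 2![case/orP=> [/orP[/orP[]|]|] /eqP->] => //;
  do ?[exact: commute_refl | exact: commute1 | exact/commute_sym/commute1
      | exact/commute_sym | exact: ca4 | exact/commute_sym/ca4].
Qed.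

End Presented.

Theorem mainTheorem7 (p : nat) (p_pr : prime p) (p_gt3 : (3 < p)%N)
    (gT : finGroupType) (G : {group gT}) (a1 a2 a3 a4 : gT)
    (presG : presented p G a1 a2 a3 a4)
    (alpha : {perm gT}) (autG : alpha \in Aut G) :
  exists u1 u2 u3 u4 v2 v3 v4 : 'I_p,
    [/\ (u1 != 0 :> nat) /\ (v2 != 0 :> nat),
        alpha a1 = a1 ^+ u1 * a2 ^+ u2 * a3 ^+ u3 * a4 ^+ u4,
        alpha a2 = a2 ^+ v2 * a3 ^+ v3 * a4 ^+ v4,
        alpha a3 = a3 ^+ (u1 * v2)
      & alpha a4 = a4 ^+ u1].
Proof.
have p_odd : odd p by have [p2|//] := even_prime p_pr; rewrite p2 in p_gt3.
have [Ga1 Ga2 Ga3 Ga4] := presented_mem presG.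
have [Za3 Za4] := presented_center presG.
have [_ _ [defR defX] [a2p a3p a4p] _] := presG.
have alphaG := Aut_closed autG.
have alphaX x n : x \in G -> alpha (x ^+ n) = alpha x ^+ n.
  exact: (morphX (autm autG)).
have alphaR x y : x \in G -> y \in G -> alpha [~ x, y] = [~ alpha x, alpha y].
  exact: (morphR (autm autG)).
have alpha_eq1 x : (alpha x == 1) = (x == 1).
  have alpha1 : alpha 1 = 1 := morph1 (autm autG).
  by rewrite -{1}alpha1 (inj_eq perm_inj).
have Zc k l : a3 ^+ k * a4 ^+ l \in 'Z(G) by rewrite groupM ?groupX.
have Zcp k l : (a3 ^+ k * a4 ^+ l) ^+ p = 1.
  rewrite expgMn; last by case/centerP: (groupX k Za3) => _; apply; rewrite groupX.
  by rewrite !(expgAC _ _ p) a3p a4p !expg1n mulg1.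
have [u1 [u2 [u3 [u4 au]]]] := presented_normal_form p_pr presG (alphaG _ Ga1).
have [v1 [v2 [v3 [v4 av]]]] := presented_normal_form p_pr presG (alphaG _ Ga2).
have o4 : #[a4] = p
  by exact: nt_prime_order p_pr a4p (presented_a4_neq1 p_pr p_odd presG).
have alpha4 : alpha a4 = a4 ^+ u1.
  rewrite -{1}defX alphaX // au.
  by rewrite (presented_p_power p_pr p_odd presG _ _ (Zc u3 u4)) Zcp mulg1.
(* Since a2 has order p, so has its image, whereas (alpha a2) ^+ p = a4 ^+ v1. *)
have v1_0 : v1 = 0 :> nat.
  have : a4 ^+ v1 == 1.
    have := presented_p_power p_pr p_odd presG v1 v2 (Zc v3 v4).
    rewrite Zcp mulg1 -av -alphaX // a2p => <-.
    by rewrite alpha_eq1.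
  by rewrite -order_dvdn o4 /dvdn modn_small // => /eqP.
have {}av : alpha a2 = a2 ^+ v2 * (a3 ^+ v3 * a4 ^+ v4).
  by rewrite av v1_0 expg0 mul1g.
have alpha3 : alpha a3 = a3 ^+ (u1 * v2).
  by rewrite -{1}defR alphaR // au av (presented_commutator presG).
exists u1, u2, u3, u4, v2, v3, v4; split=> //; first last.
- by rewrite av mulgA.
- by rewrite au mulgA.
split.
  apply: contraNneq (presented_a4_neq1 p_pr p_odd presG) => u1_0.
  by rewrite -alpha_eq1 alpha4 u1_0.
apply: contraNneq (presented_a3_neq1 p_pr presG) => v2_0.
by rewrite -alpha_eq1 alpha3 v2_0 muln0.
Qed.
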